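(* Let $G=(\mathbb{N}_0,w)$ be a physical linear graph satisfying $\mathrm{CD}(0,\infty)$, write $w_n=w(n,n+1)$, and let $\sigma$ be the intrinsic path metric $$\sigma(x,y)=\inf\sum_{i=0}^{k-1}\big(\max\{\mathrm{Deg}(x_i),\mathrm{Deg}(x_{i+1})\}\big)^{-1/2},$$ the infimum being over all walks $x=x_0\sim x_1\sim\dots\sim x_k=y$. Then, with volume growth understood with respect to $\sigma$: (a) $G$ has linear volume growth if and only if $\{w_n\}_{n=0}^\infty$ is bounded; (b) $G$ has intermediate volume growth if and only if $\{w_n\}_{n=0}^\infty$ is unbounded and $\lim_{n\to\infty}(w_{2n+2}-w_{2n})=0$; (c) $G$ has quadratic volume growth if and only if $\lim_{n\to\infty}(w_{2n+2}-w_{2n})>0$.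
   Context: A weighted graph $G=(V,E,w,m)$ is a connected, undirected, simple, locally finite graph $(V,E)$ with vertex weights $m:V\to(0,\infty)$ and symmetric edge weights $w:E\to(0,\infty)$, $w(x,y)=w(y,x)$ (with $w(x,y)=0$ if $x\not\sim y$). It is physical if $m\equiv 1$. A linear graph on $\mathbb{N}_0=\{0,1,2,\dots\}$ has vertex set $V=\mathbb{N}_0$ and edge set $E=\{\{n,n+1\}: n\in\mathbb{N}_0\}$. The weighted degree is $\mathrm{Deg}(x)=\frac1{m(x)}\sum_{y\sim x}w(x,y)$; $B_r^\sigma(x)=\{y\in V:\sigma(x,y)\le r\}$; $m(A)=\sum_{x\in A}m(x)$. For positive functions $h,k$, $h(r)\in\Theta(k(r))$ as $r\to\infty$ means there are positive constants $C_1,C_2,r_0$ with $C_1k(r)\le h(r)\le C_2k(r)$ for $r\ge r_0$. $G$ has linear volume growth if $m(B_r^\sigma(0))\in\Theta(r)$; quadratic volume growth if $m(B_r^\sigma(0))\in\Theta(r^2)$; intermediate volume growth if $\lim_{r\to\infty}m(B_r^\sigma(0))/r=\infty$ and $\lim_{r\to\infty}m(B_r^\sigma(0))/r^2=0$. The Laplacian is $\Delta f(x)=\frac1{m(x)}\sum_{y\sim x}w(x,y)(f(y)-f(x))$ for $f:V\to\mathbb{R}$. Set $\Gamma(f,g)=\frac12(\Delta(fg)-f\Delta g-g\Delta f)$, $\Gamma(f)=\Gamma(f,f)$, and $\Gamma_2(f)=\frac12\Delta\Gamma(f)-\Gamma(f,\Delta f)$. For $K\in\mathbb{R}$, $D\in(0,\infty]$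 (with $1/\infty=0$) and $x\in V$, the condition $\mathrm{CD}(K,D,x)$ means $\Gamma_2(f)(x)\ge\frac1D(\Delta f(x))^2+K\,\Gamma(f)(x)$ for all $f:V\to\mathbb{R}$; $\mathrm{CD}(K,D)$ means that $\mathrm{CD}(K,D,x)$ holds for all $x\in V$. *)

(* Defs.v *)
From HB Require Import structures.
From mathcomp Require Import all_boot all_order all_algebra.
From mathcomp Require Import all_classical all_reals all_analysis.

Set Implicit Arguments.
Unset Strict Implicit.
Unset Printing Implicit Defensive.

Import Order.TTheory GRing.Theory Num.Theory.
Import numFieldNormedType.Exports.

Local Open Scope classical_set_scope.
Local Open Scope ring_scope.

Record weighted_graph (R : realType) (V : choiceType) := WeightedGraph {
  adj : rel V ;
  weight : V -> V -> R ;
  mass : V -> R ;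
  adj_sym : symmetric adj ;
  adj_irrefl : irreflexive adj ;
  adj_locally_finite : forall x, finite_set [set y | adj x y] ;
  adj_connected : forall x y, exists2 p : seq V, path adj x p & last x p = y ;
  weight_sym : forall x y, weight x y = weight y x ;
  weight_gt0 : forall x y, adj x y -> 0 < weight x y ;
  weight_eq0 : forall x y, ~~ adj x y -> weight x y = 0 ;
  mass_gt0 : forall x, 0 < mass x
}.

Section WeightedGraph.
Context {R : realType} {V : choiceType} (G : weighted_graph R V).

Definition physical : Prop := forall x, mass G x = 1.

Definition Deg (x : V) : R :=
  (mass G x)^-1 * \sum_(y \in [set y | adj G x y]) weight G x y.

Definition laplacian (f : V -> R) (x : V) : R :=
  (mass G x)^-1 *
    \sum_(y \in [set y | adj G x y]) weight G x y * (f y - f x).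

Definition Gamma (f g : V -> R) (x : V) : R :=
  2^-1 * (laplacian (fun y => f y * g y) x
          - f x * laplacian g x - g x * laplacian f x).

Definition Gamma2 (f : V -> R) (x : V) : R :=
  2^-1 * laplacian (Gamma f f) x - Gamma f (laplacian f) x.

(* The dimension D is meant to range over ]0, +oo], with 1/+oo = 0. *)
Definition CD_at (K : R) (D : \bar R) (x : V) : Prop :=
  forall f : V -> R,
    (if D is d%:E then d^-1 else 0) * laplacian f x ^+ 2 + K * Gamma f f x
      <= Gamma2 f x.

Definition CD (K : R) (D : \bar R) : Prop := forall x, CD_at K D x.

(* Length of the walk visiting x and then the vertices of p in order. *)
Definition walk_length (x : V) (p : seq V) : R :=
  \sum_(0 <= i < size p)
    (Num.sqrt (Num.max (Deg (nth x (x :: p) i))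
                       (Deg (nth x (x :: p) i.+1))))^-1.

Definition path_metric (x y : V) : R :=
  inf [set walk_length x p | p in [set p | path (adj G) x p /\ last x p = y]].

(* Valued in \bar R, since a ball may contain infinitely many vertices. *)
Definition ball_mass (d : V -> V -> R) (x : V) (r : R) : \bar R :=
  \esum_(y in [set y | d x y <= r]) (mass G y)%:E.

End WeightedGraph.

Definition Theta {R : realType} (h : R -> \bar R) (k : R -> R) : Prop :=
  exists C1 C2 r0 : R, [/\ 0 < C1, 0 < C2, 0 < r0 &
    forall r, r0 <= r -> ((C1 * k r)%:E <= h r <= (C2 * k r)%:E)%E].

Section LinearGraph.
Context {R : realType} (G : weighted_graph R nat).

Definition linear_graph : Prop :=
  forall x y, adj G x y = (y == x.+1) || (x == y.+1).

Definition edge_weight (n : nat) : R := weight G n n.+1.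

Definition linear_volume_growth (d : nat -> nat -> R) : Prop :=
  Theta (ball_mass G d 0%N) (fun r => r).

Definition quadratic_volume_growth (d : nat -> nat -> R) : Prop :=
  Theta (ball_mass G d 0%N) (fun r => r ^+ 2).

Definition intermediate_volume_growth (d : nat -> nat -> R) : Prop :=
  (ball_mass G d 0%N r * (r^-1)%:E)%E @[r --> +oo] --> +oo%E /\
  (ball_mass G d 0%N r * (r ^- 2)%:E)%E @[r --> +oo] --> 0%E.

End LinearGraph.

(* Main.v *)
(* Write w_n for the weight of {n, n+1}, with w_{-1} = 0, and put
   t_n = (w_{n+1} + w_{n-1}) / w_n. Testing CD(0,oo) at n >= 1 gives
   t_{n-1} + t_n <= 4. Hence neighbouring weights are within a factor 4 of each
   other, and w_{n+2} + 2 w_n + w_{n-2} <= (4 - t_n)(w_{n+1} + w_{n-1})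
   = (4 - t_n) t_n w_n <= 4 w_n, so that n |-> w_{2n} is concave; being
   positive, it is nondecreasing and its increments decrease to some l >= 0.
   The distance from 0 to n is the length S_n of the ray, a sum of terms
   comparable to w_i^{-1/2}, and counting {n : S_n <= r} gives linear growth if
   w is bounded, intermediate growth if w is unbounded and l = 0, and quadratic
   growth if l > 0. These cases are exhaustive and the three growth types are
   mutually exclusive, which yields the converse implications. *)

Require Import Defs.
From mathcomp Require Import all_boot all_order all_algebra.
From mathcomp Require Import all_classical all_reals all_analysis.
From mathcomp Require Import ring lra.

Set Implicit Arguments.
Unset Strict Implicit.
Unset Printing Implicit Defensive.

Import Order.TTheory GRing.Theory Num.Theory.
Import numFieldNormedType.Exports.

Local Open Scope classical_set_scope.
Local Open Scope ring_scope.

Section LinearGraphCalculus.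
Context (R : realType) (G : weighted_graph R nat).
Hypotheses (Glin : linear_graph G) (Gphys : physical G).

Local Notation w := (edge_weight G).

(* The truncated predecessor is harmless: at 0 it gives the weight of a loop,
   which is 0. *)
Let wl n := weight G n n.-1.

Lemma left_weight0 : wl 0 = 0.
Proof. by apply: weight_eq0; rewrite adj_irrefl. Qed.

Lemma left_weightS n : wl n.+1 = w n.
Proof. exact: weight_sym. Qed.

Lemma edge_weight_gt0 n : 0 < w n.
Proof. by apply: weight_gt0; rewrite Glin eqxx. Qed.

Lemma sum_neighbours (h : nat -> R) n :
  \sum_(y \in [set y | adj G n y]) weight G n y * h y
  = w n * h n.+1 + wl n * h n.-1.
Proof.
case: n => [|n].
  rewrite left_weight0 mul0r addr0 (_ : [set y | adj G 0 y] = [set 1%N]).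
    by rewrite fsbig_set1.
  by apply/seteqP; split=> y /=; rewrite Glin /= orbF => /eqP.
rewrite (_ : [set y | adj G n.+1 y] = [set n.+2] `|` [set n]).
  rewrite fsbigU //; first by rewrite !fsbig_set1.
  by move=> y /= [-> /eqP]; rewrite eqn_leq ltnNge leqnSn.
apply/seteqP; split=> y /=; rewrite Glin eqSS.
  by case/orP => /eqP ->; [left|right].
by case=> ->; rewrite eqxx ?orbT.
Qed.

Lemma laplacian_linear f n :
  laplacian G f n = w n * (f n.+1 - f n) + wl n * (f n.-1 - f n).
Proof.
by rewrite /laplacian Gphys invr1 mul1r (sum_neighbours (fun y => f y - f n)).
Qed.

Lemma Deg_linear n : Deg G n = w n + wl n.
Proof.
rewrite /Deg Gphys invr1 mul1r -[RHS]/(w n + wl n) -[w n in RHS]mulr1.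
rewrite -[wl n in RHS]mulr1 -(sum_neighbours (fun=> 1)).
by apply: eq_fsbigr => y _; rewrite mulr1.
Qed.

Lemma edge_weight_le_Deg n : w n <= Deg G n.
Proof.
rewrite Deg_linear lerDl; case: n => [|n]; first by rewrite left_weight0.
by rewrite left_weightS ltW ?edge_weight_gt0.
Qed.

Let t n := (w n.+1 + wl n) / w n.

(* The test function vanishes at n.+1 and has increment 1/w on both inner
   edges; repeating it on the adjacent outer edge minimises Gamma2. *)
Lemma CD_ratio n : CD G 0 +oo%E -> t n + t n.+1 <= 4.
Proof.
move=> /(_ n.+1).
pose f k := if (n < k)%N then (k - n.+1)%:R / w n.+1
            else - ((n.+1 - k)%:R / w n).
move=> /(_ f); rewrite !mul0r addr0.
have q0 : w n != 0 by rewrite gt_eqF ?edge_weight_gt0.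
have p0 : w n.+1 != 0 by rewrite gt_eqF ?edge_weight_gt0.
have fE k : f k = if (n < k)%N then (k - n.+1)%:R / w n.+1
                  else - ((n.+1 - k)%:R / w n) by [].
have fl : wl n * f n.-1 = - (wl n * (2 / w n)).
  case: n @f {fE} q0 p0 => [|n] f q0 p0; first by rewrite left_weight0 !mul0r oppr0.
  rewrite /f /= ltnNge (leq_trans (leqnSn n)) //= mulrN.
  by rewrite subSn ?subSnn ?leqnSn.
have fl2 : wl n * f n.-1 ^+ 2 = wl n * (2 / w n) ^+ 2.
  rewrite expr2 mulrA fl; case: n @f {fE} q0 p0 fl => [|n] f q0 p0 fl.
    by rewrite left_weight0 !mul0r oppr0 mul0r.
  rewrite /f /= ltnNge (leq_trans (leqnSn n)) //= mulrNN.
  by rewrite subSn ?leqnSn // subSnn expr2 !mulrA.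
have f0 : f n = - (w n)^-1 by rewrite fE ltnn subSnn mul1r.
have f1 : f n.+1 = 0 by rewrite fE leqnn subnn mul0r.
have f2 : f n.+2 = (w n.+1)^-1 by rewrite fE leqnSn subSnn mul1r.
have f3 : f n.+3 = 2 / w n.+1.
  by rewrite fE (leq_trans (leqnSn n.+1)) // subSS subSn // subSnn.
suff -> : Gamma2 G f n.+1 = 4^-1 * (4 - (t n + t n.+1)).
  by rewrite pmulr_rge0 ?invr_gt0 ?ltr0n // subr_ge0.
rewrite /Gamma2 /Gamma !laplacian_linear !left_weightS /=.
rewrite f0 f1 f2 f3.
have fl' : wl n * (f n.-1 - f n) = - (wl n / w n).
  by rewrite mulrBr fl f0; field.
have fl'2 : wl n * (f n.-1 * f n.-1 - f n * f n) = 3 * wl n / w n ^+ 2.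
  by rewrite mulrBr -!expr2 fl2 f0; field.
rewrite f0 in fl' fl'2.
rewrite fl' fl'2 /t left_weightS.
field; rewrite ?q0 ?p0 //.
Qed.

Hypothesis GCD : CD G 0 +oo%E.

Let t_ge0 n : 0 <= t n.
Proof.
rewrite /t divr_ge0 ?(ltW (edge_weight_gt0 _)) //
  addr_ge0 ?(ltW (edge_weight_gt0 _)) //.
case: n => [|n]; first by rewrite left_weight0.
by rewrite left_weightS ltW ?edge_weight_gt0.
Qed.

Lemma edge_weightS_le n : w n.+1 <= 4 * w n.
Proof.
have := CD_ratio n GCD; have := t_ge0 n.+1 => t1 t2.
have : t n <= 4 by lra.
rewrite /t ler_pdivrMr ?edge_weight_gt0 // => h.
suff : 0 <= wl n by lra.
case: n {t1 t2 h} => [|n]; first by rewrite left_weight0.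
by rewrite left_weightS ltW ?edge_weight_gt0.
Qed.

Lemma edge_weight_leS n : w n <= 4 * w n.+1.
Proof.
have := CD_ratio n GCD; have := t_ge0 n => t1 t2.
have : t n.+1 <= 4 by lra.
rewrite /t ler_pdivrMr ?edge_weight_gt0 // left_weightS.
have := edge_weight_gt0 n.+2; lra.
Qed.

(* With T := w n.+1 + w n.+3 and u := T / w n.+2, CD at n.+2 and n.+3 bounds
   the ratios at n.+1 and n.+3 by 4 - u, and (4 - u) u <= 4. *)
Lemma edge_weight_concave n : w n.+4 + w n <= 2 * w n.+2.
Proof.
have := CD_ratio n.+1 GCD; have := CD_ratio n.+2 GCD.
rewrite /t !left_weightS.
have := edge_weight_gt0 n; have := edge_weight_gt0 n.+1.
have := edge_weight_gt0 n.+2; have := edge_weight_gt0 n.+3.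
move: (w n) (w n.+1) (w n.+2) (w n.+3) (w n.+4) => a b c d e d0 c0 b0 a0.
set u := (d + b) / c => h1 h2.
have {}h1 : (e + c) <= (4 - u) * d by rewrite -ler_pdivrMr //; lra.
have {}h2 : (c + a) <= (4 - u) * b by rewrite -ler_pdivrMr //; lra.
have uc : d + b = u * c by rewrite /u; field; rewrite gt_eqF.
have : (4 - u) * u * c <= 4 * c.
  by rewrite ler_pM2r //; have := sqr_ge0 (u - 2); lra.
nra.
Qed.

End LinearGraphCalculus.

Section LinearGraphMetric.
Context (R : realType) (G : weighted_graph R nat).
Hypotheses (Glin : linear_graph G) (Gphys : physical G).

Definition edge_length (i : nat) : R :=
  (Num.sqrt (Num.max (Deg G i) (Deg G i.+1)))^-1.

Definition ray_length (n : nat) : R := \sum_(0 <= i < n) edge_length i.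

Lemma ray_lengthS n : ray_length n.+1 = ray_length n + edge_length n.
Proof. by rewrite /ray_length big_nat_recr. Qed.

Lemma ray_length0 : ray_length 0 = 0.
Proof. by rewrite /ray_length big_nil. Qed.

Lemma edge_length_ge0 i : 0 <= edge_length i.
Proof. by rewrite invr_ge0 sqrtr_ge0. Qed.

Lemma ray_length_nondecreasing :
  {homo ray_length : m n / (m <= n)%N >-> m <= n}.
Proof.
by apply: homo_leq => [|y x z|n]; [|exact: le_trans|
  rewrite ray_lengthS lerDl edge_length_ge0].
Qed.

Lemma walk_length_cons x y (p : seq nat) : walk_length G x (y :: p) =
  (Num.sqrt (Num.max (Deg G x) (Deg G y)))^-1 + walk_length G y p.
Proof.
rewrite /walk_length [size _]/= big_nat_recl //; congr (_ + _).
apply: eq_big_nat => i /andP[_ ip] /=; congr (Num.sqrt (Num.max _ _))^-1.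
  by congr Deg; apply: (set_nth_default y x (s := y :: p)); rewrite /= ltnW.
by congr Deg; apply: set_nth_default.
Qed.

Lemma walk_length_ge x p : path (adj G) x p ->
  ray_length (last x p) - ray_length x <= walk_length G x p.
Proof.
elim: p x => [|y p IHp] x /=; first by rewrite subrr /walk_length big_nil.
case/andP => xy /IHp yp; rewrite walk_length_cons.
suff : ray_length y - ray_length x <=
    (Num.sqrt (Num.max (Deg G x) (Deg G y)))^-1 by lra.
move: xy; rewrite Glin => /orP[] /eqP ->.
  by rewrite ray_lengthS addrC addKr.
have := ray_length_nondecreasing (leqnSn y).
have : 0 <= (Num.sqrt (Num.max (Deg G y.+1) (Deg G y)))^-1.
  by rewrite invr_ge0 sqrtr_ge0.
lra.
Qed.

Lemma straight_walk x n :
  path (adj G) x (iota x.+1 n) /\ last x (iota x.+1 n) = (x + n)%N /\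
  walk_length G x (iota x.+1 n) = ray_length (x + n) - ray_length x.
Proof.
elim: n x => [|n IHn] x /=.
  by rewrite addn0 subrr /walk_length big_nil.
have [pn [ln wn]] := IHn x.+1; split; [|split].
- by rewrite Glin eqxx.
- by rewrite ln addSnnS.
- by rewrite walk_length_cons wn ray_lengthS addSnnS /edge_length; lra.
Qed.

Lemma path_metric_ray n : path_metric G 0%N n = ray_length n.
Proof.
have [pn [ln wn]] := straight_walk 0 n.
rewrite add0n ray_length0 subr0 in ln wn.
have lb : lbound [set walk_length G 0%N p | p in
    [set p | path (adj G) 0%N p /\ last 0%N p = n]] (ray_length n).
  move=> _ [p [/walk_length_ge + lp] <-].
  by rewrite lp ray_length0 subr0.
apply/eqP; rewrite eq_le; apply/andP; split.
  by rewrite -wn; apply: ge_inf; [exists (ray_length n) | exists (iota 1 n)].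
by apply: lb_le_inf => //; exists (ray_length n), (iota 1 n).
Qed.

Lemma esum_mass_initial n : \esum_(y in `I_n) (mass G y)%:E = n%:R%:E.
Proof.
rewrite esum_fset; last 2 first.
- exact: finite_II.
- by move=> i _; rewrite lee_fin (ltW (mass_gt0 _ _)).
rewrite -fsbig_ord sumEFin; congr EFin.
under eq_bigr do rewrite Gphys.
by rewrite sumr_const card_ord.
Qed.

Lemma ball_mass_ge r n : ray_length n <= r ->
  (n.+1%:R%:E <= ball_mass G (path_metric G) 0%N r)%E.
Proof.
move=> nr; rewrite -esum_mass_initial /ball_mass.
rewrite esum_mkcond [leRHS]esum_mkcond; apply: le_esum => i _.
case: ifPn => [|_]; last by case: ifPn; rewrite // lee_fin Gphys.
rewrite inE /= ltnS => ni; rewrite ifT // inE /= path_metric_ray.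
exact: le_trans (ray_length_nondecreasing ni) nr.
Qed.

Lemma ball_mass_le r n : r < ray_length n ->
  (ball_mass G (path_metric G) 0%N r <= n%:R%:E)%E.
Proof.
move=> nr; rewrite -esum_mass_initial /ball_mass.
rewrite esum_mkcond [leRHS]esum_mkcond; apply: le_esum => i _.
case: ifPn => [|_]; last by case: ifPn; rewrite // lee_fin Gphys.
rewrite inE /= path_metric_ray => ir; rewrite ifT // inE /= ltnNge.
by apply/negP => /ray_length_nondecreasing ni; lra.
Qed.

End LinearGraphMetric.

Section Increments.
Context (R : realType).

Lemma increments_le (f g : nat -> R) i n : (i <= n)%N ->
  (forall j, (i <= j)%N -> f j.+1 - f j <= g j.+1 - g j) ->
  f n - f i <= g n - g i.
Proof.
move=> + fg; elim: n => [|n IHn]; first by rewrite leqn0 => /eqP ->; rewrite !subrr.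
rewrite leq_eqVlt ltnS => /orP[/eqP <-|/[dup] /IHn + /fg]; last by lra.
by rewrite !subrr.
Qed.

Lemma sqrt_increment_bounds (i : nat) :
  Num.sqrt (i.+1%:R : R) - Num.sqrt (i%:R : R)
    <= (Num.sqrt (i.+1%:R : R))^-1
    <= 2 * (Num.sqrt (i.+1%:R : R) - Num.sqrt (i%:R : R)).
Proof.
have s0 : 0 < Num.sqrt i.+1%:R :> R by rewrite sqrtr_gt0.
have t0 : 0 <= Num.sqrt i%:R :> R by exact: sqrtr_ge0.
have s2 : Num.sqrt i.+1%:R ^+ 2 = i.+1%:R :> R by rewrite sqr_sqrtr.
have t2 : Num.sqrt i%:R ^+ 2 = i%:R :> R by rewrite sqr_sqrtr.
have st : Num.sqrt i.+1%:R ^+ 2 = Num.sqrt i%:R ^+ 2 + 1 :> R.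
  by rewrite s2 t2 -natr1.
move: (Num.sqrt i.+1%:R) (Num.sqrt i%:R) s0 t0 st => s t s0 t0 st.
rewrite -[s^-1]mul1r ler_pdivlMr // ler_pdivrMr //.
by apply/andP; split; nra.
Qed.

End Increments.

Lemma squeeze_to0e (R : realType) (T : Type) (F : set_system T)
    (FF : Filter F) (f : T -> \bar R) :
  (forall e : R, 0 < e -> \forall x \near F, (0 <= f x <= e%:E)%E) ->
  f x @[x --> F] --> 0%E.
Proof.
move=> fe; apply/fine_cvgP; split.
  near=> x; have /andP[f0 f1] : (0 <= f x <= 1%:E)%E.
    by near: x; exact: fe.
  by rewrite ge0_fin_numE // (le_lt_trans f1) // ltry.
apply/cvgrPdist_le => e e0; near=> x.
have /andP[f0 f1] : (0 <= f x <= e%:E)%E by near: x; exact: fe.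
rewrite sub0r normrN ger0_norm ?fine_ge0 //.
by rewrite -lee_fin fineK // ge0_fin_numE // (le_lt_trans f1) // ltry.
Unshelve. all: by end_near.
Qed.

Section CountingGrowth.
Context (R : realType) (S : nat -> R) (N : R -> \bar R).
Hypothesis N_ge0 : forall r, (0 <= N r)%E.
Hypothesis N_ge : forall r n, S n <= r -> (n.+1%:R%:E <= N r)%E.
Hypothesis N_le : forall r n, r < S n -> (N r <= n%:R%:E)%E.

Lemma count_ge x r : 0 <= x -> (forall n, n%:R <= x -> S n <= r) ->
  (x%:E <= N r)%E.
Proof.
move=> x0 Sr; have /andP[tx xt] := truncn_itv x0.
by apply: le_trans (N_ge (Sr _ tx)); rewrite lee_fin ltW.
Qed.

Lemma count_le x r : 0 <= x -> (forall n, x < n%:R -> r < S n) ->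
  (N r <= (x + 1)%:E)%E.
Proof.
move=> x0 Sr; have /andP[tx xt] := truncn_itv x0.
by apply: le_trans (N_le (Sr _ xt)) _; rewrite lee_fin -natr1 lerD2r.
Qed.

Lemma Theta_linear c C : 0 < c -> 0 < C ->
  (forall n, c * n%:R <= S n <= C * n%:R) -> Theta N (fun r => r).
Proof.
move=> c0 C0 cSC; exists C^-1, (c^-1 + 1), 1.
split; rewrite ?invr_gt0 ?addr_gt0 ?invr_gt0 ?ltr01 // => r r1.
have r0 : 0 <= r by lra.
apply/andP; split.
  apply: count_ge => [|n]; first by rewrite mulr_ge0 ?invr_ge0 ?(ltW C0).
  rewrite ler_pdivlMl // => nr; have /andP[_] := cSC n; lra.
apply: le_trans (count_le (x := c^-1 * r) _ _) _.
- by rewrite mulr_ge0 ?invr_ge0 ?(ltW c0).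
- by move=> n; rewrite ltr_pdivrMl // => nr; have /andP[+ _] := cSC n; lra.
- by rewrite lee_fin mulrDl mul1r lerD2l.
Qed.

Lemma Theta_quadratic c C : 0 < c -> 0 < C ->
  (forall n, c * Num.sqrt n%:R <= S n <= C * Num.sqrt n%:R) ->
  Theta N (fun r => r ^+ 2).
Proof.
move=> c0 C0 cSC; exists (C ^- 2), (c ^- 2 + 1), 1.
split; rewrite ?invr_gt0 ?addr_gt0 ?invr_gt0 ?exprn_gt0 ?ltr01 // => r r1.
have r0 : 0 <= r by lra.
apply/andP; split.
  apply: count_ge => [|n]; first by rewrite mulr_ge0 ?invr_ge0 ?exprn_ge0 ?(ltW C0).
  rewrite -exprVn -exprMn => nr; have /andP[_] := cSC n.
  move=> /le_trans; apply; rewrite -ler_pdivlMl //.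
  rewrite -[leRHS]gtr0_norm ?mulr_gt0 ?invr_gt0 //; last lra.
  by rewrite -sqrtr_sqr ler_wsqrtr.
apply: le_trans (count_le (x := c ^- 2 * r ^+ 2) _ _) _.
- by rewrite mulr_ge0 ?invr_ge0 ?exprn_ge0 ?(ltW c0).
- move=> n; rewrite -exprVn -exprMn => nr; have /andP[+ _] := cSC n.
  apply: lt_le_trans; rewrite -ltr_pdivrMl //.
  rewrite -[ltLHS]gtr0_norm ?mulr_gt0 ?invr_gt0 //; last lra.
  by rewrite -sqrtr_sqr ltr_sqrt // (le_lt_trans _ nr) // sqr_ge0.
- by rewrite lee_fin mulrDl mul1r lerD2l exprn_ege1.
Qed.

Lemma count_superlinear :
  (forall e, 0 < e -> exists2 B, 0 <= B & forall n, S n <= e * n%:R + B) ->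
  (N r * (r^-1)%:E)%E @[r --> +oo] --> +oo%E.
Proof.
move=> SE; apply/cvgeyPge => A.
pose e := (2 * (`|A| + 1))^-1.
have A0 : 0 < `|A| + 1 by rewrite ltr_wpDl.
have e0 : 0 < e by rewrite invr_gt0 mulr_gt0.
have [B B0 SB] := SE e e0.
near=> r.
have r0 : 0 < r by near: r; apply: nbhs_pinfty_gt; rewrite num_real.
have rB : 2 * B <= r by near: r; apply: nbhs_pinfty_ge; rewrite num_real.
rewrite lee_pdivlMr //.
apply: (@le_trans _ _ (e^-1 * (r - B))%:E).
  rewrite lee_fin /e invrK; have := ler_norm A.
  nra.
apply: count_ge => [|n]; first by rewrite mulr_ge0 ?invr_ge0 ?(ltW e0) //; lra.
by rewrite ler_pdivlMl // => nr; have := SB n; lra.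
Unshelve. all: by end_near.
Qed.

Lemma count_subquadratic :
  (forall K, 0 < K ->
     exists2 B, 0 <= B & forall n, K * Num.sqrt n%:R - B <= S n) ->
  (N r * (r ^- 2)%:E)%E @[r --> +oo] --> 0%E.
Proof.
move=> SK; apply: squeeze_to0e => e e0.
pose K := Num.sqrt (8 / e).
have K0 : 0 < K by rewrite sqrtr_gt0 divr_gt0.
have K2 : K ^+ 2 = 8 / e by rewrite sqr_sqrtr // divr_ge0 // ltW.
have [B B0 SB] := SK K K0.
near=> r.
have r0 : 0 < r by near: r; apply: nbhs_pinfty_gt; rewrite num_real.
have rB : B <= r by near: r; apply: nbhs_pinfty_ge; rewrite num_real.
have r1 : 1 <= r by near: r; apply: nbhs_pinfty_ge; rewrite num_real.
have re : 2 / e <= r by near: r; apply: nbhs_pinfty_ge; rewrite num_real.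
have rr : 0 < r ^+ 2 by rewrite exprn_gt0.
rewrite mule_ge0 ?N_ge0 ?lee_fin ?invr_ge0 ?(ltW rr) //=.
rewrite lee_pdivrMr //.
apply: le_trans (count_le (x := ((r + B) / K) ^+ 2) _ _) _.
- exact: sqr_ge0.
- move=> n nr; apply: lt_le_trans (SB n).
  rewrite ltrBrDr -ltr_pdivrMl // mulrC.
  rewrite -[ltLHS]ger0_norm ?divr_ge0 ?addr_ge0 ?(ltW K0) ?(ltW r0) //.
  by rewrite -sqrtr_sqr ltr_sqrt // (le_lt_trans _ nr) // sqr_ge0.
- rewrite lee_fin exprMn exprVn K2 invf_div.
  have : (r + B) ^+ 2 <= 4 * r ^+ 2 by nra.
  have : 2 <= e * r by rewrite mulrC -ler_pdivrMr.
  nra.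
Unshelve. all: by end_near.
Qed.

End CountingGrowth.

Section TwoStepConcave.
Context (R : realType) (w : nat -> R).
Hypothesis w_gt0 : forall n, 0 < w n.
Hypothesis wS_le : forall n, w n.+1 <= 4 * w n.
Hypothesis w_leS : forall n, w n <= 4 * w n.+1.
Hypothesis w_concave : forall n, w n.+4 + w n <= 2 * w n.+2.

Let v k := w (2 * k)%N.
Let d k := v k.+1 - v k.

Let vS k : v k.+1 = w (2 * k).+2.
Proof. by rewrite /v mulnS. Qed.

Let dS k : d k.+1 <= d k.
Proof.
by rewrite /d [v k.+2]vS mulnS vS /v; have := w_concave (2 * k)%N; lra.
Qed.

Let d_nonincreasing : {homo d : m n / (m <= n)%N >-> n <= m}.
Proof. by apply: homo_leq => // x y z yx zy; exact: le_trans zy yx. Qed.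

Let v_le_affine k j : (k <= j)%N -> v j - v k <= d k * (j%:R - k%:R).
Proof.
move=> kj; rewrite mulrBr; apply: (increments_le (g := fun i => d k * i%:R)) => // i ki.
by rewrite -mulrBr -natr1 addrAC subrr add0r mulr1; exact: d_nonincreasing.
Qed.

Let d_ge0 k : 0 <= d k.
Proof.
rewrite leNgt; apply/negP => dk.
pose j := (Num.truncn (v k / - d k)).+1.
have : v k / - d k < j%:R by exact: truncnS_gt.
rewrite ltr_pdivrMr ?oppr_gt0 // => vj.
have := v_le_affine (leq_addr j k); rewrite natrD addrAC subrr add0r.
have := w_gt0 (2 * (k + j))%N; rewrite -/(v _); lra.
Qed.

Let v_nondecreasing : {homo v : m n / (m <= n)%N >-> m <= n}.
Proof.
apply: homo_leq => [//|y x z|k]; first exact: le_trans.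
by rewrite -subr_ge0; exact: d_ge0.
Qed.

Let w_half n : w n <= 4 * v n./2 /\ v n./2 <= 4 * w n.
Proof.
have := odd_double_half n; rewrite /v mul2n; move: n./2.*2 => m <-.
by case: (odd n); rewrite ?add1n // add0n; have := w_gt0 m; split; lra.
Qed.

Lemma even_increments_cvg : exists2 l : R, 0 <= l &
  w (2 * n + 2)%N - w (2 * n)%N @[n --> \oo] --> l.
Proof.
have cd : cvgn d.
  by apply: nonincreasing_is_cvgn => //; exists 0 => _ [n _ <-].
exists (limn d); first by apply: limr_ge => //; near=> n; exact: d_ge0.
suff -> : (fun n => w (2 * n + 2)%N - w (2 * n)%N) = d by [].
by apply/funext => n; rewrite /d vS addn2.
Unshelve. all: by end_near.
Qed.

Lemma weight_ge_const : exists2 a, 0 < a & forall n, a <= w n.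
Proof.
exists (w 0 / 4) => [|n]; first by rewrite divr_gt0.
have [_ vw] := w_half n; have := v_nondecreasing (leq0n n./2).
by rewrite [v 0]/v muln0; lra.
Qed.

Let half_le n : (n./2)%:R <= n%:R :> R.
Proof. by rewrite ler_nat -divn2 leq_div. Qed.

Lemma weight_le_linear : exists2 A, 0 < A & forall n, w n <= A * n.+1%:R.
Proof.
exists (4 * (v 0 + d 0)) => [|n].
  by rewrite mulr_gt0 // ltr_wpDr ?w_gt0 ?d_ge0.
have [wv _] := w_half n; have := v_le_affine (leq0n n./2).
rewrite subr0 -natr1 => vn; have := half_le n; have := d_ge0 0.
have := w_gt0 0; rewrite -[w 0]/(v 0).
have := ler0n R n; nra.
Qed.

Lemma weight_unbounded : ~ (exists M, forall n, w n <= M) ->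
  forall M, exists i, forall n, (i <= n)%N -> M <= w n.
Proof.
move=> unb M; have [i wi] : exists i, 16 * M < w i.
  apply: contrapT => bnd; apply: unb; exists (16 * M) => n.
  by rewrite leNgt; apply/negP => Mn; apply: bnd; exists n.
exists i => n /half_leq /v_nondecreasing vin.
have [_ vn] := w_half n; have [wvi _] := w_half i; lra.
Qed.

Lemma weight_ge_linear (l : R) : 0 < l ->
  w (2 * n + 2)%N - w (2 * n)%N @[n --> \oo] --> l ->
  exists2 a, 0 < a & forall n, a * n.+1%:R <= w n.
Proof.
move=> l0; rewrite (_ : (fun n => _) = d); last first.
  by apply/funext => n; rewrite /d vS addn2.
move=> dl.
have ld n : l <= d n.
  have <- : limn d = l by exact/cvg_lim.
  by apply: nonincreasing_cvgn_ge => //; apply/cvg_ex; exists l.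
have vl k : v 0 + l * k%:R <= v k.
  suff : l * k%:R - l * 0%:R <= v k - v 0 by rewrite mulr0; lra.
  apply: (increments_le (f := fun i : nat => l * i%:R)) => // j _.
  by rewrite -mulrBr -natr1 addrAC subrr add0r mulr1; exact: ld.
pose m := Num.min (v 0) l.
have m0 : 0 < m by rewrite lt_min w_gt0.
exists (m / 8) => [|n]; first by rewrite divr_gt0.
have [_ vw] := w_half n; have := vl n./2.
have mv : m <= v 0 by rewrite ge_min lexx.
have ml : m <= l by rewrite ge_min lexx orbT.
have nh : n.+1%:R <= 2 * (n./2)%:R + 2 :> R.
  rewrite -natrM -natrD ler_nat -{1}(odd_double_half n) mul2n addn2 !ltnS.
  by rewrite -[leqRHS]add1n leq_add2r leq_b1.
have := ler0n R n./2; nra.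
Qed.

Lemma weight_sublinear :
  w (2 * n + 2)%N - w (2 * n)%N @[n --> \oo] --> (0 : R) ->
  forall e : R, 0 < e -> exists i, forall n, (i <= n)%N -> w n <= e * n.+1%:R.
Proof.
rewrite (_ : (fun n => _) = d); last first.
  by apply/funext => n; rewrite /d vS addn2.
move=> d0 e e0.
have [k _ dk] : \forall n \near \oo, d n <= e / 8.
  have /cvgrPdist_le /(_ (e / 8)) := d0; rewrite divr_gt0 // => /(_ isT).
  by apply: filterS => n; rewrite sub0r normrN ger0_norm // d_ge0.
have {}dk : d k <= e / 8 by exact: (dk k (leqnn k)).
exists (maxn k.*2 (Num.truncn (8 * v k / e)).+1) => n; rewrite geq_max => /andP[kn vn].
have {}kn : (k <= n./2)%N by rewrite -(doubleK k) half_leq.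
have : 8 * v k / e < n%:R.
  by apply: lt_le_trans (truncnS_gt _) _; rewrite ler_nat.
rewrite ltr_pdivrMr // => {}vn.
have [wv _] := w_half n; have := v_le_affine kn; have := half_le n.
have := ler0n R k; have := ler0n R n; have := d_ge0 k.
have : k%:R <= n./2%:R :> R by rewrite ler_nat.
rewrite -natr1.
nra.
Qed.

End TwoStepConcave.

Section GrowthExclusivity.
Context (R : realType) (N : R -> \bar R).

Lemma Theta_linear_quadratic :
  Theta N (fun r => r) -> Theta N (fun r => r ^+ 2) -> False.
Proof.
move=> [C' [C [r0 [_ C0 r00 up]]]] [c [c' [s0 [c0 _ s00 low]]]].
pose r := r0 + s0 + C / c.
have Cc : 0 < C / c by rewrite divr_gt0.
have r0r : r0 <= r by rewrite /r; lra.
have s0r : s0 <= r by rewrite /r; lra.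
have /andP[_ Nr] := up r r0r; have /andP[rN _] := low r s0r.
have := le_trans rN Nr; rewrite lee_fin.
have : c * r = c * (r0 + s0) + C by rewrite /r; field; rewrite gt_eqF.
have : 0 < c * (r0 + s0) by rewrite mulr_gt0 // addr_gt0.
have : 0 < r by rewrite /r; lra.
nra.
Qed.

Lemma Theta_linear_superlinear :
  Theta N (fun r => r) -> (N r * (r^-1)%:E)%E @[r --> +oo] --> +oo%E -> False.
Proof.
move=> [C' [C [r0 [_ C0 r00 up]]]] /cvgeyPge /(_ (C + 1)) Ny.
have : \forall r \near +oo%R, (r : R) < r.
  near=> r; exfalso.
  have r0r : r0 <= r by near: r; apply: nbhs_pinfty_ge; rewrite num_real.
  have rp : 0 < r by exact: lt_le_trans r0r.
  have : ((C + 1)%:E <= N r * (r^-1)%:E)%E by near: r.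
  rewrite lee_pdivlMr // => rN; have /andP[_ Nr] := up r r0r.
  by have := le_trans rN Nr; rewrite lee_fin; nra.
by case/filter_ex => r; rewrite ltxx.
Unshelve. all: by end_near.
Qed.

Lemma Theta_quadratic_subquadratic :
  Theta N (fun r => r ^+ 2) -> (N r * (r ^- 2)%:E)%E @[r --> +oo] --> 0%E ->
  False.
Proof.
move=> [c [c' [r0 [c0 _ r00 low]]]] /fine_cvgP[Nfin].
move=> /cvgrPdist_lt /(_ c c0) Nc.
have : \forall r \near +oo%R, (r : R) < r.
  near=> r; exfalso.
  have r0r : r0 <= r by near: r; apply: nbhs_pinfty_ge; rewrite num_real.
  have r2 : 0 < r ^+ 2 by rewrite exprn_gt0 // (lt_le_trans r00).
  have Nf : (N r * (r ^- 2)%:E)%E \is a fin_num by near: r.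
  have : `|0 - fine (N r * (r ^- 2)%:E)| < c by near: r.
  have /andP[+ _] := low r r0r.
  rewrite EFinM -lee_pdivlMr // -[X in (_ <= X)%E]fineK // lee_fin => cN.
  by rewrite sub0r normrN ger0_norm ?ltNge ?cN // (le_trans _ cN) // ltW.
by case/filter_ex => r; rewrite ltxx.
Unshelve. all: by end_near.
Qed.

End GrowthExclusivity.

Section RayGrowth.
Context (R : realType) (G : weighted_graph R nat).
Hypotheses (Glin : linear_graph G) (Gphys : physical G) (GCD : CD G 0 +oo%E).

Local Notation w := (edge_weight G).
Local Notation S := (ray_length G).

Let N_ge0 r : (0 <= ball_mass G (path_metric G) 0%N r)%E.
Proof. by apply: esum_ge0 => n _; rewrite lee_fin (ltW (mass_gt0 _ _)). Qed.

Lemma max_Deg_bounds n :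
  w n <= Num.max (Deg G n) (Deg G n.+1) <= 5 * w n.
Proof.
rewrite le_max edge_weight_le_Deg // ge_max /= !Deg_linear // left_weightS.
have w0 := edge_weight_gt0 Glin n.
have -> : w n.+1 + w n <= 5 * w n.
  by have := edge_weightS_le Glin Gphys GCD n; lra.
rewrite andbT; case: n w0 => [|n] w0; first by rewrite left_weight0; lra.
by rewrite left_weightS; have := edge_weight_leS Glin Gphys GCD n; lra.
Qed.

Lemma edge_length_le a n : 0 < a -> a <= w n ->
  edge_length G n <= (Num.sqrt a)^-1.
Proof.
move=> a0 aw; have /andP[wD _] := max_Deg_bounds n.
have D0 := lt_le_trans a0 (le_trans aw wD).
by rewrite lef_pV2 ?posrE ?sqrtr_gt0 // ler_wsqrtr // (le_trans aw).
Qed.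

Lemma edge_length_ge a n : w n <= a ->
  (Num.sqrt (5 * a))^-1 <= edge_length G n.
Proof.
move=> wa; have /andP[wD Dw] := max_Deg_bounds n.
have w0 := edge_weight_gt0 Glin n.
rewrite lef_pV2 ?posrE ?sqrtr_gt0 ?(lt_le_trans w0 wD) //; last by lra.
by rewrite ler_wsqrtr // (le_trans Dw) // ler_pM2l.
Qed.

Lemma ray_length_le (g : nat -> R) i : (forall n, 0 <= g n) ->
  (forall n, (i <= n)%N -> edge_length G n <= g n.+1 - g n) ->
  forall n, S n <= g n + S i.
Proof.
move=> g0 Sg n; have [ni|/ltnW ni] := leqP i n.
  have : S n - S i <= g n - g i; last by have := g0 i; lra.
  by apply: increments_le => // j ij; rewrite ray_lengthS addrC addKr Sg.
have := ray_length_nondecreasing G ni; have := g0 n; lra.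
Qed.

Lemma ray_length_ge (g : nat -> R) i :
  {homo g : m n / (m <= n)%N >-> m <= n} ->
  (forall n, (i <= n)%N -> g n.+1 - g n <= edge_length G n) ->
  forall n, g n - g i <= S n.
Proof.
move=> g_nd gS n; have [ni|/ltnW ni] := leqP i n.
  have : g n - g i <= S n - S i.
    by apply: increments_le => // j ij; rewrite ray_lengthS [leRHS]addrC addKr gS.
  have := ray_length_nondecreasing G (leq0n i); rewrite ray_length0; lra.
have := g_nd _ _ ni.
have := ray_length_nondecreasing G (leq0n n); rewrite ray_length0; lra.
Qed.

Let linear_increment (c : R) (n : nat) : c * n.+1%:R - c * n%:R = c.
Proof. by rewrite -natr1; lra. Qed.

Let sqrt_nondecreasing (c : R) : 0 <= c ->
  {homo (fun n : nat => c * Num.sqrt (n%:R : R)) : m n / (m <= n)%N >-> m <= n}.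
Proof. by move=> c0 m n mn; rewrite ler_wpM2l // ler_wsqrtr // ler_nat. Qed.

Lemma ray_length_sqrt_le a : 0 < a -> (forall n, a * n.+1%:R <= w n) ->
  forall n, S n <= 2 / Num.sqrt a * Num.sqrt n%:R.
Proof.
move=> a0 aw n; rewrite -[leRHS]addr0 -(ray_length0 G).
have c0 : 0 <= 2 / Num.sqrt a by rewrite divr_ge0 ?sqrtr_ge0.
apply: (ray_length_le (g := fun n => 2 / Num.sqrt a * Num.sqrt n%:R)) => j.
  by rewrite mulr_ge0 ?sqrtr_ge0.
move=> _; apply: le_trans (edge_length_le _ (aw j)) _; first by rewrite mulr_gt0.
rewrite sqrtrM ?(ltW a0) // invfM -mulrBr mulrAC [leLHS]mulrC.
rewrite ler_wpM2r ?invr_ge0 ?sqrtr_ge0 //.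
by have /andP[] := sqrt_increment_bounds R j.
Qed.

Lemma ray_length_sqrt_ge a i : 0 < a ->
  (forall n, (i <= n)%N -> w n <= a * n.+1%:R) ->
  forall n, (Num.sqrt (5 * a))^-1 * Num.sqrt n%:R
            - (Num.sqrt (5 * a))^-1 * Num.sqrt i%:R <= S n.
Proof.
move=> a0 wa; apply: ray_length_ge => [|n ni].
  by apply: sqrt_nondecreasing; rewrite invr_ge0 sqrtr_ge0.
apply: le_trans (edge_length_ge (wa n ni)).
have a5 : 0 <= 5 * a by rewrite mulr_ge0 // ltW.
rewrite mulrA (sqrtrM _ a5) invfM -mulrBr ler_wpM2l ?invr_ge0 ?sqrtr_ge0 //.
by have /andP[] := sqrt_increment_bounds R n.
Qed.

Let wgt0 := edge_weight_gt0 Glin.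
Let wS_le := edge_weightS_le Glin Gphys GCD.
Let w_leS := edge_weight_leS Glin Gphys GCD.
Let w_concave := edge_weight_concave Glin Gphys GCD.

Lemma ray_length_sqrt_ge_global : exists2 c : R, 0 < c &
  forall n, c * Num.sqrt n%:R <= S n.
Proof.
have [A A0 wA] := weight_le_linear wgt0 wS_le w_leS w_concave.
exists (Num.sqrt (5 * A))^-1 => [|n].
  by rewrite invr_gt0 sqrtr_gt0 mulr_gt0.
have := ray_length_sqrt_ge A0 (fun n (_ : (0 <= n)%N) => wA n) n.
by rewrite sqrtr0 mulr0 subr0.
Qed.

Lemma ray_length_le_linear : exists2 c : R, 0 < c & forall n, S n <= c * n%:R.
Proof.
have [a a0 aw] := weight_ge_const wgt0 wS_le w_leS w_concave.
have c0 : 0 < (Num.sqrt a)^-1 by rewrite invr_gt0 sqrtr_gt0.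
exists (Num.sqrt a)^-1 => // n; rewrite -[leRHS]addr0 -(ray_length0 G).
apply: (ray_length_le (g := fun n => (Num.sqrt a)^-1 * n%:R)) => j.
  by rewrite mulr_ge0 // ltW.
by move=> _; rewrite linear_increment edge_length_le.
Qed.

Lemma edge_weight_boundedP : bounded_fun w <-> exists M, forall n, w n <= M.
Proof.
split=> [/pinfty_ex_gt0[M M0 wM]|[M wM]].
  by exists M => n; apply: le_trans (ler_norm _) (wM n I).
exists M; split; first by rewrite num_real.
by move=> x Mx n _ /=; rewrite ger0_norm ?ltW // (le_lt_trans (wM n)).
Qed.

Lemma linear_growth_of_bounded : bounded_fun w ->
  linear_volume_growth G (path_metric G).
Proof.
move=> /edge_weight_boundedP[M wM].
have M0 : 0 < M by apply: lt_le_trans (wM 0%N).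
have [C C0 SC] := ray_length_le_linear.
have c0 : 0 < (Num.sqrt (5 * M))^-1 by rewrite invr_gt0 sqrtr_gt0 mulr_gt0.
apply: (Theta_linear (ball_mass_ge Glin Gphys) (ball_mass_le Glin Gphys) c0 C0).
move=> n; rewrite SC andbT.
rewrite -[leLHS]subr0 -[X in _ - X](mulr0 (Num.sqrt (5 * M))^-1).
apply: (ray_length_ge (g := fun n => (Num.sqrt (5 * M))^-1 * n%:R) (i := 0%N)).
  by move=> i j ij; rewrite ler_pM2l // ler_nat.
by move=> j _; rewrite linear_increment edge_length_ge.
Qed.

Lemma quadratic_growth_of_increments (l : R) : 0 < l ->
  w (2 * n + 2)%N - w (2 * n)%N @[n --> \oo] --> l ->
  quadratic_volume_growth G (path_metric G).
Proof.
move=> l0 wl; have [a a0 aw] :=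
  weight_ge_linear wgt0 wS_le w_leS w_concave l0 wl.
have [c c0 cS] := ray_length_sqrt_ge_global.
apply: (Theta_quadratic (ball_mass_ge Glin Gphys) (ball_mass_le Glin Gphys) c0
  (C := 2 / Num.sqrt a)); first by rewrite divr_gt0 ?sqrtr_gt0.
by move=> n; rewrite cS ray_length_sqrt_le.
Qed.

Lemma intermediate_growth_of_increments : ~ bounded_fun w ->
  w (2 * n + 2)%N - w (2 * n)%N @[n --> \oo] --> (0 : R) ->
  intermediate_volume_growth G (path_metric G).
Proof.
move=> unb wl; split.
  apply: (count_superlinear (ball_mass_ge Glin Gphys)) => e e0.
  have [|i wi] := weight_unbounded wgt0 wS_le w_leS w_concave _ (e ^- 2).
    by move=> bnd; apply: unb; exact/edge_weight_boundedP.
  exists (S i); first by rewrite -(ray_length0 G) ray_length_nondecreasing.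
  apply: (ray_length_le (g := fun n => e * n%:R)) => n.
    by rewrite mulr_ge0 // ltW.
  move=> ni; rewrite linear_increment.
  apply: le_trans (edge_length_le _ (wi n ni)) _.
    by rewrite invr_gt0 exprn_gt0.
  by rewrite -exprVn sqrtr_sqr ger0_norm ?invrK // invr_ge0 ltW.
apply: (count_subquadratic N_ge0 (ball_mass_le Glin Gphys)) => K K0.
pose e := (5 * K ^+ 2)^-1.
have e0 : 0 < e by rewrite invr_gt0 mulr_gt0 // exprn_gt0.
have [i wi] := weight_sublinear wgt0 wS_le w_leS w_concave wl e0.
have eK : (Num.sqrt (5 * e))^-1 = K.
  have -> : 5 * e = K^-1 ^+ 2 by rewrite /e; field; rewrite gt_eqF.
  by rewrite sqrtr_sqr ger0_norm ?invrK // invr_ge0 ltW.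
exists (K * Num.sqrt i%:R); first by rewrite mulr_ge0 ?sqrtr_ge0 // ltW.
by have := ray_length_sqrt_ge e0 wi; rewrite eK.
Qed.

End RayGrowth.

Theorem corollary3p14 (R : realType) (G : weighted_graph R nat)
    (Glin : linear_graph G) (Gphys : physical G) (GCD : CD G 0 +oo%E) :
  [/\ linear_volume_growth G (path_metric G) <-> bounded_fun (edge_weight G),
      intermediate_volume_growth G (path_metric G) <->
        ~ bounded_fun (edge_weight G) /\
        edge_weight G (2 * n + 2)%N - edge_weight G (2 * n)%N
          @[n --> \oo] --> (0 : R)
    & quadratic_volume_growth G (path_metric G) <->
        exists2 l : R, 0 < l &
          edge_weight G (2 * n + 2)%N - edge_weight G (2 * n)%N
            @[n --> \oo] --> l].
Proof.
have wgt0 := edge_weight_gt0 Glin.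
have w_concave := edge_weight_concave Glin Gphys GCD.
have [l l0 wl] := even_increments_cvg wgt0 w_concave.
have lin := linear_growth_of_bounded Glin Gphys GCD.
have quad := quadratic_growth_of_increments Glin Gphys GCD.
have inter := intermediate_growth_of_increments Glin Gphys GCD.
have l_cases : l = 0 \/ 0 < l.
  by move: l0; rewrite le_eqVlt => /orP[/eqP|]; [left|right].
split; split.
- move=> Glinear; apply: contrapT => unb.
  case: l_cases => [l_eq0|lp].
    move: wl; rewrite l_eq0 => wl; have [sup _] := inter unb wl.
    exact: Theta_linear_superlinear Glinear sup.
  exact: Theta_linear_quadratic Glinear (quad _ lp wl).
- exact: lin.
- move=> [sup sub]; split.
    by move=> /lin Glinear; exact: Theta_linear_superlinear Glinear sup.
  case: l_cases => [<- //|lp].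
  by case: (Theta_quadratic_subquadratic (quad _ lp wl) sub).
- by case=> unb wl0; exact: inter.
- move=> Gquad; case: l_cases => [l_eq0|lp]; last by exists l.
  exfalso; move: wl; rewrite l_eq0 => wl.
  have [bnd|unb] := pselect (bounded_fun (edge_weight G)).
    exact: Theta_linear_quadratic (lin bnd) Gquad.
  have [_ sub] := inter unb wl.
  exact: Theta_quadratic_subquadratic Gquad sub.
- by case=> l' lp' wl'; exact: quad wl'.
Qed.
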